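(* Suppose $Z(t)$, $t\ge0$, is a stochastic process with regenerative increments over the renewal times $T_n$. Let $M_1:=\sup_{0\le t\le T_1}|Z(t)|$ and $a:=\mathbb{E}[Z(T_1)]/\mathbb{E}[T_1]$. Let $0<r\le1$. (i) If $\mathbb{E}[T_1^{2-r}]$, $\mathbb{E}[M_1]$, and $\mathbb{E}[T_1^{1-r}M_1]$ are finite, then $$\mathbb{E}[Z(t)]=at+o(t^r)\qquad\text{as } t\to\infty.$$ (ii) In particular, $\mathbb{E}[Z(t)]=at+o(t^r)$ as $t\to\infty$ holds if there exist $p\ge2-r$ and $q\ge1$ such that $\mathbb{E}[T_1^p]$ and $\mathbb{E}[M_1^q]$ are finite, and $$p\Bigl(1-\frac1q\Bigr)\ge1-r.$$
   Context: Renewal times: $T_0:=0$ and $T_n:=\sum_{i=1}^n\xi_i$ for $n\ge 1$, where $(\xi_i)_{i\ge1}$ are i.i.d. strictly positive random variables (so $0<T_1<T_2<\cdots$ and $\xi_n=T_n-T_{n-1}$). $Z=(Z(t))_{t\ge0}$ is a real-valued stochastic process with continuous time parameter $t\in[0,\infty)$ and càdlàg (right-continuous with left limits) paths. The process $Z(t)$ has regenerative increments over the times $T_n$ if $Z(0)=0$ and the increments $$\zeta_n:=\bigl(\xi_n,\ \{Z(t+T_{n-1})-Z(T_{n-1}):0\le t\le\xi_n\}\bigr),\qquad n\ge1,$$ are i.i.d. Here the second component, defined on the random interval $[0,\xi_n]$, is regarded as a process on $[0,\infty)$ stopped at $\xi_n$, i.e. equal to $Z(\xi_n+T_{n-1})-Z(T_{n-1})$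 for all $t\ge\xi_n$, so it is a random càdlàg function on $[0,\infty)$. *)

(* Defs.v *)
From HB Require Import structures.
From mathcomp Require Import all_boot all_order all_algebra finmap.
From mathcomp Require Import all_classical all_reals all_analysis.
Import Order.TTheory GRing.Theory Num.Theory.
Import numFieldNormedType.Exports.

Set Implicit Arguments.
Unset Strict Implicit.
Unset Printing Implicit Defensive.

Local Open Scope classical_set_scope.
Local Open Scope ring_scope.

(* [pinfty_nbhs R] packed with its proof of being a filter, as required by the
   Landau notations. *)
Definition at_pinfty (R : realType) : filter_on R :=
  FilterType (pinfty_nbhs R) _.

Section iid.
Context {d d' : measure_display} {Omega : measurableType d}
  {U : measurableType d'} {R : realType}.
Variables (P : probability Omega R) (X : nat -> Omega -> U).

Definition mutually_independent :=
  forall (J : {fset nat}) (B : nat -> set U),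
    (forall n, n \in J -> measurable (B n)) ->
    P (\bigcap_(n in [set` J]) (X n @^-1` B n)) =
    (\prod_(n <- J) P (X n @^-1` B n))%E.

Definition identically_distributed :=
  forall (m n : nat) (B : set U), measurable B ->
    P (X m @^-1` B) = P (X n @^-1` B).

Definition iid :=
  [/\ forall n, measurable_fun setT (X n),
      mutually_independent & identically_distributed].

End iid.

Section trajectories.
Variable R : realType.

Definition cylinders : set (set ({nonneg R} -> R)) :=
  [set C | exists (t : {nonneg R}) (B : set R),
     measurable B /\ C = [set f | B (f t)]].

(* Functions on [0, +oo) with the sigma-algebra generated by the evaluations.
   On the subset of cadlag functions its trace is the Borel sigma-algebra of the
   Skorokhod topology, so for a random variable with cadlag values (the only
   ones used below) the law and independence are the same in both spaces. *)
Definition trajectory := g_sigma_algebraType cylinders.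

(* A path on [0, +oo) is a function on R, whose values at negative times are
   irrelevant. *)
Definition cadlag (f : R -> R) :=
  (forall t, 0 <= t -> f x @[x --> t^'+] --> f t) /\
  (forall t, 0 < t -> cvg (f x @[x --> t^'-])).

End trajectories.

Section regenerative.
Context {d : measure_display} {Omega : measurableType d} {R : realType}.
Variables (P : probability Omega R) (xi : nat -> Omega -> R)
  (Z : R -> Omega -> R).

(* The sequence xi_1, xi_2, ... is indexed here from 0: [xi n] is
   xi_(n+1). *)
Definition renewal_time (n : nat) (w : Omega) : R := \sum_(i < n) xi i w.

Definition renewal_steps := iid P xi /\ (forall n w, 0 < xi n w).

Definition cadlag_process :=
  (forall t, 0 <= t -> measurable_fun setT (Z t)) /\
  (forall w, cadlag (Z ^~ w)).

(* [increment n] is zeta_(n+1), over the interval from T_n to T_(n+1). *)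
Definition increment (n : nat) (w : Omega) : R * trajectory R :=
  (xi n w,
   fun t : {nonneg R} =>
     Z (Num.min t%:num (xi n w) + renewal_time n w) w - Z (renewal_time n w) w).

Definition regenerative_increments :=
  (forall w, Z 0 w = 0) /\ iid P increment.

Definition sup_first_cycle (w : Omega) : R :=
  sup [set `|Z t w| | t in `[0, renewal_time 1 w]].

Definition mean_drift : R :=
  fine 'E_P[fun w => Z (renewal_time 1 w) w] / fine 'E_P[renewal_time 1].

(* E[Z(t)] = a t + o(t^r), including the existence of E[Z(t)], which [fine]
   alone would not express. *)
Definition mean_asymptotics (r : R) :=
  (forall t, 0 <= t -> P.-integrable setT (EFin \o Z t)) /\
  (fun t => fine 'E_P[Z t]) =
    (fun t => mean_drift * t) +o_ (at_pinfty R) (fun t => t `^ r).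

End regenerative.

(* Main.v *)
Require Import Defs.
From mathcomp Require Import all_boot all_order all_algebra finmap.
From mathcomp Require Import all_classical all_reals all_analysis.
From mathcomp Require Import measurable_realfun.
From mathcomp Require Import ring lra.
Import Order.TTheory GRing.Theory Num.Theory.
Import numFieldNormedType.Exports.

Set Implicit Arguments.
Unset Strict Implicit.
Unset Printing Implicit Defensive.

Local Open Scope classical_set_scope.
Local Open Scope ring_scope.

(** The idea is to compare [Z t] with its value at the end of the cycle that
    contains [t].

    Let [a] be the drift and let [Y t = Z t - a * t].  Over a complete cycle [Y]
    has an increment of mean zero.  Whether the cycle starting at [T n] starts
    before [t] depends on the earlier cycles alone, hence is independent of that
    increment; so the mean of [Y] at the end of the cycle containing [t] is zero
    (Wald's identity), and [E (Y t)] is the mean of the difference between [Y t]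
    and that final value.  The difference is at most [W = 2 M + |a| xi], computed
    from the cycle containing [t].

    It remains to bound the mean of [W] on the cycle that contains [t].  That
    cycle is longer than the time elapsed since its start.  Cut the past of [t]
    into windows of a length [e] that a step exceeds with positive probability.
    The expected number of renewals in a window is bounded by a constant [C]: at
    most one of them is followed by a step longer than [e], and each is with that
    same probability ([expected_renewals_window]).  Charging each cycle to the
    window in which it starts ([expected_marks_le]) gives
      [|E (Y t)| <= C * \sum_(k <= t / e) E (W_1; xi_1 > k * e)]
    ([drifted_mean_le]).

    Finally the number of [k <= t / e] with [k * e < x] is at most about
    [min (t / e) (x / e) <= (t / e) ^ r * (x / e) ^ (1 - r)], so the sum is
    [O(t ^ r)] as soon as [W_1] and [W_1 * xi_1 ^ (1 - r)] have finite means, and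
    it is [o(t ^ r)] because only large values of [xi_1] contribute at that order
    ([long_cycles_littleo]).  These means are finite by the hypotheses of the first
    part, and the second part reduces to the first by Young's inequality. *)

(** * Independence of the past of a sequence *)

Section independence_of_the_past.
Context {d d' : measure_display} {Omega : measurableType d}
  {U : measurableType d'} {R : realType}.
Variables (P : probability Omega R) (X : nat -> Omega -> U).
Hypothesis X_iid : iid P X.
Local Open Scope ereal_scope.

Let mX n : measurable_fun setT (X n). Proof. by case: X_iid. Qed.

(** Rectangles, rather than preimages of one set by one variable, because they
    form a pi-system. *)
Definition past_rectangles (n : nat) : set (set Omega) :=
  [set \bigcap_(i in `I_n) (X i @^-1` B i) |
     B in [set B : nat -> set U | forall i, measurable (B i)]].

Definition past (n : nat) : set (set Omega) := <<s past_rectangles n >>.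

Lemma measurable_preimage_iid n (B : set U) : measurable B ->
  measurable (X n @^-1` B).
Proof. by move=> mB; rewrite -[X in measurable X]setTI; exact: mX. Qed.

Lemma past_rectangles_measurable n : past_rectangles n `<=` measurable.
Proof.
move=> _ [B mB <-]; apply: bigcap_measurableType => i _.
exact: measurable_preimage_iid.
Qed.

Lemma past_measurable n : past n `<=` measurable.
Proof.
apply: smallest_sub; first exact: sigma_algebra_measurable.
exact: past_rectangles_measurable.
Qed.

Lemma past_rectangles_setI n : setI_closed (past_rectangles n).
Proof.
move=> _ _ [B mB <-] [C mC <-]; exists (fun i => B i `&` C i).
  by move=> i; exact: measurableI.
by rewrite -bigcapI; apply: eq_bigcapr => i _; rewrite preimage_setI.
Qed.

Lemma past_rectangle_independent n A (B : set U) :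
  past_rectangles n A -> measurable B ->
  P (A `&` X n @^-1` B) = P A * P (X n @^-1` B).
Proof.
move=> [C mC <-] mB; have [_ Xind _] := X_iid.
pose J := fset_set `I_n; have JE : [set` J] = `I_n.
  by rewrite /J fset_setK//; exact: finite_II.
have nJ : (n \notin J)%fset.
  by rewrite /J in_fset_set ?notin_setE/= ?ltnn//; exact: finite_II.
(* [C'] adds the condition on [X n] to those that define the rectangle. *)
pose C' i := if i == n then B else C i.
have C'C i : (i \in J)%fset -> C' i = C i.
  by move=> iJ; rewrite /C'; case: eqP => // ?; subst i; rewrite iJ in nJ.
have mC' i : measurable (C' i) by rewrite /C'; case: ifP.
have := Xind (n |` J)%fset C' (fun i _ => mC' i).
rewrite big_fsetU1//= set_fsetU1 bigcap_setU1.
under eq_big_seq => i iJ do rewrite (C'C i iJ).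
rewrite -(Xind J C (fun i _ => mC i)) muleC setIC.
rewrite (_ : C' n = B); last by rewrite /C' eqxx.
rewrite (@eq_bigcapr _ _ _ _ (fun i => X i @^-1` C i)) ?JE//.
move=> i i_n; rewrite C'C //; by have : [set` J] i by rewrite JE.
Qed.

(** For a fixed [B], both sides are finite measures in [A]; they agree on the
    rectangles, hence on the sigma-algebra that these generate. *)
Lemma past_independent n A (B : set U) : past n A -> measurable B ->
  P (A `&` X n @^-1` B) = P A * P (X n @^-1` B).
Proof.
move=> pA mB; have mXB := measurable_preimage_iid n mB.
have PB0 : (0 <= fine (P (X n @^-1` B)))%R by rewrite fine_ge0.
pose m1 : {measure set Omega -> \bar R} := mrestr P mXB.
pose m2 : {measure set Omega -> \bar R} := mscale (NngNum PB0) P.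
have m2E C : m2 C = P C * P (X n @^-1` B).
  by rewrite /m2 /= /mscale/= fineK ?fin_num_measure// muleC.
rewrite -m2E -[LHS]/(m1 A).
apply: (@g_sigma_algebra_measure_unique _ _ _ (past_rectangles n) _
  (fun=> setT)) => //.
- exact: past_rectangles_measurable.
- by move=> k; exists (fun=> setT) => //; apply/seteqP; split.
- by apply/seteqP; split=> [|w _]; [|exists 0%N].
- exact: past_rectangles_setI.
- by move=> C rC; rewrite m2E -past_rectangle_independent.
- by move=> k; rewrite /m1/= /mrestr ltey_eq fin_num_measure//; exact: measurableI.
Qed.

Lemma past_preimage n i (B : set U) : (i < n)%N -> measurable B ->
  past n (X i @^-1` B).
Proof.
move=> i_n mB; apply: sub_sigma_algebra.
exists (fun j => if j == i then B else setT); first by move=> j; case: ifP.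
apply/seteqP; split=> w /=.
  by move=> /(_ i i_n) /=; rewrite eqxx.
by move=> Bw j _ /=; case: eqP => // ->.
Qed.

(** The joint law of the value of [X n] and of an earlier event is a product,
    so the restriction of [P] to the event [A] is pushed forward by [X n] to
    [P A] times the common law. *)
Lemma ge0_integral_past n A (f : U -> \bar R) : past n A ->
  measurable_fun setT f -> (forall u, 0 <= f u) ->
  \int[P]_(w in A) f (X n w) = P A * \int[P]_w f (X 0 w).
Proof.
move=> pA mf f0; have mA := past_measurable pA.
have PA0 : (0 <= fine (P A))%R by rewrite fine_ge0.
have [_ _ X_id] := X_iid.
pose PA : {measure set Omega -> \bar R} := mrestr P mA.
have mfX k : measurable_fun setT (fun w => f (X k w))
  by exact: (measurableT_comp mf).
transitivity (\int[PA]_w f (X n w)).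
  rewrite (@ge0_negligible_integral _ _ _ PA setT (~` A))//; last 2 first.
  - exact: measurableC.
  - by rewrite /PA/= /mrestr setICl measure0.
  rewrite setTD setCK; apply: eq_measure_integral => C mC CA.
  by rewrite /PA/= /mrestr setIidl.
transitivity (\int[pushforward PA (X n)]_u f u).
  by rewrite ge0_integral_pushforward//.
transitivity (\int[pushforward (mscale (NngNum PA0) P) (X 0%N)]_u f u).
  apply: eq_measure_integral => C mC _.
  rewrite /PA /= /mscale /pushforward /mrestr /= fineK ?fin_num_measure//.
  by rewrite setIC past_independent// (X_id n 0%N).
rewrite ge0_integral_pushforward// preimage_setT ge0_integral_mscale//=.
  by rewrite fineK ?fin_num_measure.
exact: mfX.
Qed.

Lemma integral_past n A (f : U -> \bar R) : past n A ->
  measurable_fun setT f -> P.-integrable setT (fun w => f (X 0%N w)) ->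
  \int[P]_(w in A) f (X n w) = P A * \int[P]_w f (X 0%N w).
Proof.
move=> pA mf f_int; rewrite integralE [X in _ = _ * X]integralE.
have f_pos := integrable_pos_fin_num measurableT f_int.
have f_neg := integrable_neg_fin_num measurableT f_int.
rewrite muleBr ?fin_num_adde_defl ?fin_numN ?fin_num_measure//; last first.
  exact: past_measurable pA.
have posE k : (fun w => f (X k w))^\+ = (fun w => f^\+ (X k w)).
  by apply/funext => w; rewrite !funeposE.
have negE k : (fun w => f (X k w))^\- = (fun w => f^\- (X k w)).
  by apply/funext => w; rewrite !funenegE.
rewrite !posE !negE.
by congr (_ - _); rewrite (@ge0_integral_past n)//;
  [exact: measurable_funepos|exact: measurable_funeneg].
Qed.

Lemma ge0_integral_iid n (f : U -> \bar R) :
  measurable_fun setT f -> (forall u, 0 <= f u) ->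
  \int[P]_w f (X n w) = \int[P]_w f (X 0%N w).
Proof.
move=> mf f0; rewrite (@ge0_integral_past n) ?probability_setT ?mul1e//.
exact: (@measurableT _ (g_sigma_algebraType (past_rectangles n))).
Qed.

End independence_of_the_past.

(** * Renewals and marks *)

Section renewal.
Context {d d' : measure_display} {Omega : measurableType d}
  {U : measurableType d'} {R : realType}.
Variables (P : probability Omega R) (X : nat -> Omega -> U) (step : U -> R).
Hypothesis X_iid : iid P X.
Hypothesis mstep : measurable_fun setT step.
Hypothesis step_gt0 : forall n w, 0 < step (X n w).

Local Notation T := (renewal_time (fun n w => step (X n w))).

Lemma renewal_time0 w : T 0%N w = 0.
Proof. by rewrite /renewal_time big_ord0. Qed.

Lemma renewal_timeS n w : T n.+1 w = T n w + step (X n w).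
Proof. by rewrite /renewal_time big_ord_recr. Qed.

Lemma renewal_time_homo w : {homo T ^~ w : m n / (m <= n)%N >-> m <= n}.
Proof.
apply: homo_leq => [x|y x z|n]; [exact: lexx|exact: le_trans|].
by rewrite renewal_timeS lerDl ltW.
Qed.

Lemma renewal_time_ge0 n w : 0 <= T n w.
Proof. by rewrite -(renewal_time0 w) renewal_time_homo. Qed.

(** [T n] is a function of the first [n] steps only. *)
Lemma past_renewal_time n (B : set R) : measurable B ->
  past X n (T n @^-1` B).
Proof.
move=> mB; pose Past := g_sigma_algebraType (past_rectangles X n).
have mT m : (m <= n)%N -> measurable_fun setT (T m : Past -> R).
  elim: m => [_|m IH mn].
    rewrite (_ : T 0%N = cst 0); first exact: measurable_cst.
    by apply/funext => w; rewrite renewal_time0.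
  rewrite (_ : T m.+1 = (fun w => (T m w + (step \o X m) w)%R)); last first.
    by apply/funext => w; rewrite renewal_timeS.
  apply: measurable_funD; first by apply: IH; exact: ltnW.
  move=> _ C mC; rewrite setTI comp_preimage.
  apply: past_preimage => //.
  by rewrite -[Y in measurable Y]setTI; exact: mstep.
by rewrite -[X in past _ _ X]setTI; exact: (mT n (leqnn n)).
Qed.

Lemma measurable_renewal_time n (B : set R) : measurable B ->
  measurable (T n @^-1` B).
Proof.
by move=> mB; exact: (past_measurable X_iid (@past_renewal_time n B mB)).
Qed.

Local Open Scope ereal_scope.

Let long (e : R) : set U := step @^-1` `]e, +oo[.

Let mlong e : measurable (long e).
Proof. by rewrite -[X in measurable X]setTI; exact: mstep. Qed.

(** At most one renewal in a window of length [e] is followed by a step longer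
    than [e], because that step leaves the window; and whether it is that long
    is independent of where the renewal took place. *)
Lemma expected_renewals_window (s e : R) :
  (\sum_(n <oo) P (T n @^-1` `]s, (s + e)%R])) * P (X 0%N @^-1` long e) <= 1.
Proof.
pose E n := T n @^-1` `]s, (s + e)%R] `&` X n @^-1` long e.
have mE n : measurable (E n).
  apply: measurableI; first exact: measurable_renewal_time.
  exact: (measurable_preimage_iid X_iid).
have E_triv : trivIset setT E.
  apply/ltn_trivIset => n m mn; apply/seteqP; split=> // w [[]] /=.
  rewrite /long /= !in_itv/= andbT => /andP[sTm _] em [].
  rewrite /= in_itv => /andP[_ Tn_le] _.
  have := renewal_time_homo w mn; rewrite renewal_timeS.
  by rewrite leNgt => /negP; apply; rewrite (le_lt_trans Tn_le)// ltrD.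
have -> : (\sum_(n <oo) P (T n @^-1` `]s, (s + e)%R])) * P (X 0%N @^-1` long e)
    = \sum_(n <oo) P (E n).
  rewrite muleC -[P (X 0%N @^-1` _)]fineK ?fin_num_measure//; last first.
    exact: (measurable_preimage_iid X_iid).
  rewrite -nneseriesZl//; apply: eq_eseriesr => n _.
  rewrite fineK ?fin_num_measure//; last exact: (measurable_preimage_iid X_iid).
  have pw : past X n (T n @^-1` `]s, (s + e)%R]).
    by apply: past_renewal_time; exact: measurable_itv.
  rewrite /E (past_independent X_iid pw (mlong e)) muleC.
  by congr (_ * _); case: X_iid => _ _; exact.
have mUE : measurable (\bigcup_n E n) by exact: bigcup_measurable.
rewrite -(measure_semi_bigcup P mE E_triv mUE).
exact: probability_le1.
Qed.

Lemma long_step_exists : exists2 e : R, (0 < e)%R & 0 < P (X 0%N @^-1` long e).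
Proof.
apply: contrapT => no_e.
have P0 n : P.-negligible (X 0%N @^-1` long n.+1%:R^-1).
  apply/negligibleP; first exact: (measurable_preimage_iid X_iid).
  apply/eqP; rewrite eq_le measure_ge0 andbT leNgt; apply/negP => Pn.
  by apply: no_e; exists n.+1%:R^-1%R.
suff PT0 : P setT = 0.
  by move/eqP: PT0; rewrite probability_setT onee_eq0.
apply/negligibleP => //; apply: negligibleS (negligible_bigcup P0) => w _.
have [n ltn] := ltr_add_invr (step_gt0 0%N w).
by exists n => //=; rewrite /long/= in_itv/= andbT; rewrite add0r in ltn.
Qed.

Lemma expected_renewals_bounded : exists e C : R, [/\ (0 < e)%R, (0 <= C)%R &
  forall s, \sum_(n <oo) P (T n @^-1` `]s, (s + e)%R]) <= C%:E].
Proof.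
have [e e0 Pe] := long_step_exists.
have Pfin : P (X 0%N @^-1` long e) \is a fin_num.
  by rewrite fin_num_measure//; exact: (measurable_preimage_iid X_iid).
have p0 : (0 < fine (P (X 0%N @^-1` long e)))%R.
  by rewrite fine_gt0// Pe ltey_eq Pfin.
exists e, (fine (P (X 0%N @^-1` long e)))^-1%R; split=> // [|s].
  by rewrite invr_ge0 ltW.
rewrite -[leRHS]mul1e lee_pdivlMr// fineK//.
exact: expected_renewals_window.
Qed.

Lemma expected_marks_window (e C s : R) (g : U -> \bar R) :
  (forall s, \sum_(n <oo) P (T n @^-1` `]s, (s + e)%R]) <= C%:E) ->
  measurable_fun setT g -> (forall u, 0 <= g u) ->
  \int[P]_w g (X 0%N w) < +oo ->
  \sum_(n <oo) \int[P]_(w in T n @^-1` `]s, (s + e)%R]) g (X n w) <=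
  C%:E * \int[P]_w g (X 0%N w).
Proof.
move=> UC mg g0 g_fin; set I := \int[P]_w g (X 0%N w).
have I0 : 0 <= I by exact: integral_ge0.
have IE : I = (fine I)%:E by rewrite fineK// ge0_fin_numE.
rewrite (_ : \sum_(n <oo) _ =
    I * \sum_(n <oo) P (T n @^-1` `]s, (s + e)%R])); last first.
  rewrite IE -nneseriesZl//; apply: eq_eseriesr => n _; rewrite -IE muleC.
  apply: (ge0_integral_past X_iid) => //.
  by apply: past_renewal_time; exact: measurable_itv.
by rewrite muleC lee_wpmul2r.
Qed.

(** Going back from [t], [x] lies in window number [k], so at least [k * e]
    has elapsed since [x]. *)
Lemma window_cover (e t x : R) : (0 < e)%R -> (0 <= x <= t)%R ->
  exists2 k, (k < (Num.truncn (t / e)).+1)%N &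
    (k%:R * e <= t - x)%R /\
    x \in `](t - k.+1%:R * e)%R, (t - k.+1%:R * e + e)%R].
Proof.
move=> e0 /andP[x0 xt]; exists (Num.truncn ((t - x) / e)).
  by rewrite ltnS le_truncn// ler_pM2r ?invr_gt0// gerBl.
have tx0 : (0 <= (t - x) / e)%R by rewrite divr_ge0 ?subr_ge0// ltW.
have := truncn_itv tx0; rewrite ler_pdivlMr// ltr_pdivrMr// => /andP[le_k lt_k].
split=> //; rewrite in_itv/=.
move: le_k lt_k; set k := Num.truncn _; rewrite -natr1 => le_k lt_k.
by apply/andP; split; lra.
Qed.

(** A mark carried by a renewal before time [t] is charged to the window, counted
    backwards from [t], that contains the renewal; each window receives a bounded
    expected number of renewals. *)
Lemma expected_marks_le (e C t : R) (f : U -> \bar R) (g : nat -> U -> \bar R)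
    (A : nat -> set Omega) :
  (0 < e)%R ->
  (forall s, \sum_(n <oo) P (T n @^-1` `]s, (s + e)%R]) <= C%:E) ->
  measurable_fun setT f -> (forall u, 0 <= f u) ->
  (forall k, measurable_fun setT (g k)) -> (forall k u, 0 <= g k u) ->
  (forall k, \int[P]_w g k (X 0%N w) < +oo) ->
  (forall n, measurable (A n)) ->
  (forall n w, A n w -> (T n w <= t)%R) ->
  (forall n k w, A n w -> (k%:R * e <= t - T n w)%R ->
    f (X n w) <= g k (X n w)) ->
  \sum_(n <oo) \int[P]_(w in A n) f (X n w) <=
  C%:E * \sum_(k < (Num.truncn (t / e)).+1) \int[P]_w g k (X 0%N w).
Proof.
move=> e0 UC mf f0 mg g0 g_fin mA At fg; set K := (Num.truncn (t / e)).+1.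
pose B n k := T n @^-1` `](t - k.+1%:R * e)%R, (t - k.+1%:R * e + e)%R].
have mB n k : measurable (B n k).
  by apply: measurable_renewal_time; exact: measurable_itv.
have mX n : measurable_fun setT (X n) by case: X_iid.
have mgX n k : measurable_fun setT (fun w => g k (X n w)).
  exact: (measurableT_comp (mg k)).
have mgB n k : measurable_fun setT ((fun w => g k (X n w)) \_ (B n k)).
  by apply/(measurable_restrictT _ (mB n k)); exact: measurable_funTS.
have gB0 n k w : 0 <= ((fun w => g k (X n w)) \_ (B n k)) w.
  by rewrite patchE; case: ifP.
apply: (@le_trans _ _
    (\sum_(n <oo) \sum_(k < K) \int[P]_(w in B n k) g k (X n w))).
  apply: lee_nneseries => n _; first by move=> _; exact: integral_ge0.
  under [leRHS]eq_bigr do rewrite integral_mkcond.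
  rewrite -ge0_integral_sum// [leLHS]integral_mkcond.
  apply: ge0_le_integral => //.
  - by move=> w _; rewrite patchE; case: ifP.
  - apply/(measurable_restrictT _ (mA n)); apply: measurable_funTS.
    exact: (measurableT_comp mf).
  - exact: emeasurable_sum.
  move=> w _; rewrite patchE; case: ifPn => [|_]; last exact: sume_ge0.
  rewrite inE => Aw.
  have x_itv : (0 <= T n w <= t)%R by rewrite renewal_time_ge0 At.
  have [k kK [le_k kB]] := window_cover e0 x_itv.
  rewrite (bigD1 (Ordinal kK))//= patchE mem_set//.
  by rewrite (le_trans (fg _ _ _ Aw le_k))// leeDl// sume_ge0.
rewrite nneseries_sum; last by move=> k n _; exact: integral_ge0.
rewrite ge0_sume_distrr; last by move=> k _; exact: integral_ge0.
by apply: lee_sum => k _; exact: expected_marks_window.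
Qed.

End renewal.

(** * Measurable functionals of a trajectory *)

Section trajectory_functionals.
Variable R : realType.
Implicit Types (z : R -> R) (f : trajectory R).

Lemma measurable_evaluation (t : {nonneg R}) :
  measurable_fun [set: trajectory R] (fun f => f t).
Proof.
move=> _ B mB; rewrite setTI; apply: sub_sigma_algebra.
by exists t, B.
Qed.

(** The absolute value keeps the enumeration of the rationals inside the
    nonnegative reals, and the default value [0] serves for the integers that
    encode no rational. *)
Definition rational_time (n : nat) : {nonneg R} :=
  `|ratr (odflt 0 (choice.unpickle n : option rat))|%:nng.

Lemma rational_time_dense (x y : R) : 0 <= x -> x < y ->
  exists n, x < (rational_time n)%:num < y.
Proof.
move=> x0 /rat_in_itvoo[q]; rewrite in_itv/= => /andP[xq qy].
exists (choice.pickle q); rewrite /= choice.pickleK/= ger0_norm ?xq ?qy//.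
exact: le_trans (ltW xq).
Qed.

(** Only countably many times are used, to make this measurable for the
    sigma-algebra of evaluations; on right-continuous trajectories it is the
    supremum over all times. *)
Definition trajectory_sup f : \bar R :=
  esups (fun n => `|f (rational_time n)|%:E) 0%N.

(** Evaluation of a trajectory at a random time is not measurable on the space of
    all functions.  The final value of a stopped trajectory is therefore read as
    its limit at infinity, and as an upper limit to be defined everywhere. *)
Definition trajectory_end f : \bar R :=
  limn_esup (fun n => (f (n%:R)%:nng)%:E).

Lemma measurable_trajectory_sup : measurable_fun setT trajectory_sup.
Proof.
apply: measurable_fun_esups => n; apply/measurable_EFinP.
by apply: measurableT_comp => //; exact: measurable_evaluation.
Qed.

Lemma measurable_trajectory_end : measurable_fun setT trajectory_end.
Proof.
apply: measurable_fun_limn_esup => n; apply/measurable_EFinP.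
exact: measurable_evaluation.
Qed.

Lemma trajectory_sup_ub f n : (`|f (rational_time n)|%:E <= trajectory_sup f)%E.
Proof. by apply: ereal_sup_ubound; exists n. Qed.

Lemma trajectory_sup_le f (y : \bar R) :
  (forall n, (`|f (rational_time n)|%:E <= y)%E) -> (trajectory_sup f <= y)%E.
Proof. by move=> f_le; apply: ge_ereal_sup => _ [n _ <-]. Qed.

Lemma trajectory_sup_ge0 f : (0 <= trajectory_sup f)%E.
Proof. by apply: le_trans (trajectory_sup_ub f 0); rewrite lee_fin. Qed.

Definition stopped_increment z (s x : R) : trajectory R :=
  fun t : {nonneg R} => z (Num.min t%:num x + s) - z s.

Lemma stopped_increment_end z (s x : R) :
  trajectory_end (stopped_increment z s x) = (z (s + x) - z s)%:E.
Proof.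
have cvg_end : (stopped_increment z s x (n%:R)%:nng)%:E @[n --> \oo] -->
    (z (s + x) - z s)%:E.
  apply: cvg_near_cst; near=> n.
  rewrite /stopped_increment /= min_r ?(addrC x)//.
  by near: n; exact: nbhs_infty_ger.
rewrite /trajectory_end is_cvg_limn_esupE; first exact/cvg_lim.
by apply/cvg_ex; exists (z (s + x) - z s)%:E.
Unshelve. all: by end_near. Qed.

(** The supremum over rational times is the full supremum, by right
    continuity. *)
Lemma stopped_increment_le_sup z (s x t : R) : cadlag z -> 0 <= s ->
  0 <= t <= x ->
  (`|z (s + t) - z s|%:E <= trajectory_sup (stopped_increment z s x))%E.
Proof.
move=> [z_right _] s0 /andP[t0]; rewrite le_eqVlt => /predU1P[tx|tx].
  rewrite tx in t0 *.
  have [n /andP[xn _]] := rational_time_dense t0 (ltr_pwDr ltr01 (lexx x)).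
  apply: le_trans (trajectory_sup_ub _ n).
  by rewrite /stopped_increment min_r ?(addrC x)// ltW.
rewrite leNgt; apply/negP => sup_lt.
have := trajectory_sup_ub (stopped_increment z s x).
have := trajectory_sup_ge0 (stopped_increment z s x).
case: (trajectory_sup _) sup_lt => [r| |]//; rewrite lte_fin => r_lt _ r_ub.
have norm_right : `|z u - z s| @[u --> (s + t)^'+] --> `|z (s + t) - z s|.
  by apply: cvg_norm; apply: cvgB; [apply: z_right; exact: addr_ge0|exact: cvg_cst].
have [e /= e0 near_gt] := cvgr_gt _ norm_right _ r_lt.
have t_lt : t < Num.min (t + e) x by rewrite lt_min ltrDl e0 tx.
have [n] := rational_time_dense t0 t_lt.
rewrite lt_min => /and3P[tn nte nx].
have := r_ub n; rewrite leNgt => /negP; apply.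
rewrite lte_fin /stopped_increment min_l ?ltW// (addrC _ s).
apply: near_gt; last by rewrite ltrD2l.
by rewrite /= opprD addrACA subrr add0r distrC ger0_norm ?subr_ge0 ?ltW// ltrBlDl.
Qed.

(** The one-sided limits bound the path near each point.  Compactness of the
    interval is used as a near-covering property, for the filter of arbitrarily
    large bounds. *)
Lemma cadlag_bounded z (b : R) : cadlag z ->
  exists C, forall t, 0 <= t <= b -> `|z t| <= C.
Proof.
move=> [z_right z_left].
have := (compact_near_coveringP _).1 (@segment_compact R 0 b).
move=> /(_ R (pinfty_nbhs R) (fun C t => 0 <= t -> `|z t| <= C)).
case.
- move=> t /=; rewrite in_itv/= => /andP[t0 _].
  suff [C zC] : exists C, \forall u \near t, 0 <= u -> `|z u| <= C.
    exists ([set u | 0 <= u -> `|z u| <= C], [set D | C <= D]).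
      by split => //; exact: (nbhs_pinfty_ge (num_real C)).
    by move=> [u D] [/= zu CD] u0; exact: le_trans (zu u0) CD.
  have right_bd : \forall u \near t, t < u -> `|z u| <= `|z t| + 1.
    by apply: (cvgr_norm_le _ (z_right _ t0)); rewrite ltrDl.
  have [C left_bd] : exists C, \forall u \near t, 0 <= u -> u < t -> `|z u| <= C.
    move: t0; rewrite le_eqVlt => /predU1P[<-|t0].
      by exists 0; near=> u => u0; rewrite ltNge u0.
    have /cvg_ex[l zl] := z_left _ t0.
    exists (`|l| + 1); near=> u => _.
    by near: u; apply: (cvgr_norm_le _ zl); rewrite ltrDl.
  exists (Num.max C (`|z t| + 1)); near=> u => u0.
  rewrite le_max; have [ut|tu|->] := ltgtP u t.
  - by rewrite (near left_bd u).
  - by rewrite (near right_bd u)// orbT.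
  - by rewrite lerDl ler01 orbT.
move=> C [_ zC]; exists (C + 1) => t tb.
case/andP: (tb) => t0 _.
by apply: zC => //; rewrite ?ltrDl //= in_itv.
Unshelve. all: by end_near. Qed.

(** Boundedness of the path enters here: [sup] is [0] on an unbounded set. *)
Lemma trajectory_sup_first z (x : R) : cadlag z -> z 0 = 0 -> 0 <= x ->
  trajectory_sup (stopped_increment z 0 x) =
  (sup [set `|z t| | t in `[0, x]])%:E.
Proof.
move=> cz z0 x0; set S := [set `|z t| | t in _].
have [C zC] := cadlag_bounded x cz.
have S_ub : has_sup S.
  split; first by exists `|z 0|, 0 => //=; rewrite in_itv/= lexx.
  by exists C => y [t /=]; rewrite in_itv/= => /zC ztC <-.
have q0 n : 0 <= (rational_time n)%:num by [].
apply/eqP; rewrite eq_le; apply/andP; split.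
  apply: trajectory_sup_le => n; rewrite lee_fin /stopped_increment z0 subr0.
  apply: sup_upper_bound => //; exists (Num.min (rational_time n)%:num x + 0) => //.
  by rewrite /= in_itv/= addr0 le_min q0 x0 ge_min lexx orbT.
have sup_fin : (trajectory_sup (stopped_increment z 0 x) < +oo)%E.
  apply: (@le_lt_trans _ _ C%:E); last exact: ltry.
  apply: trajectory_sup_le => n; rewrite lee_fin /stopped_increment z0 subr0.
  by apply: zC; rewrite addr0 le_min q0 x0 ge_min lexx orbT.
rewrite -[leRHS]fineK ?ge0_fin_numE ?trajectory_sup_ge0// lee_fin.
apply: ge_sup; first by case: S_ub.
move=> y [t /=]; rewrite in_itv/= => t_itv <-.
rewrite -lee_fin fineK ?ge0_fin_numE ?trajectory_sup_ge0//.
have := stopped_increment_le_sup cz (lexx 0) t_itv.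
by rewrite add0r z0 subr0.
Qed.

End trajectory_functionals.

(** * The drifted process and the end of the current cycle *)

Section regenerative_process.
Context {d : measure_display} {Omega : measurableType d} {R : realType}.
Variables (P : probability Omega R) (xi : nat -> Omega -> R)
  (Z : R -> Omega -> R).
Hypothesis xi_renewal : renewal_steps P xi.
Hypothesis Z_cadlag : cadlag_process Z.
Hypothesis Z_regenerative : regenerative_increments P xi Z.

Local Notation X := (increment xi Z).
Local Notation T := (renewal_time xi).
Local Notation step := (@fst R (trajectory R)).

Let X_iid : iid P X. Proof. by case: Z_regenerative. Qed.
Let mX n : measurable_fun setT (X n). Proof. by case: X_iid. Qed.
Let mstep : measurable_fun setT step. Proof. exact: measurable_fst. Qed.
Let step_gt0 n w : 0 < step (X n w). Proof. exact: (xi_renewal.2 n w). Qed.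
Let TS n w : T n.+1 w = T n w + xi n w.
Proof. exact: (renewal_timeS X step). Qed.
Let T0 w : T 0 w = 0. Proof. exact: (renewal_time0 X step). Qed.
Let T_ge0 n w : 0 <= T n w.
Proof. exact: (renewal_time_ge0 step_gt0). Qed.

Variable a : R.

Definition drifted (t : R) (w : Omega) : R := Z t w - a * t.

(** The increment of the drifted process over a cycle, written as a function on the
    space of regenerative increments so that their independence and their common
    law apply to it. *)
Definition drifted_end (u : R * trajectory R) : \bar R :=
  (trajectory_end u.2 - (a * u.1)%:E)%E.

(** The factor 2 makes this a bound for the increment of the drifted process from
    any time of the cycle to the end of the cycle, through its beginning. *)
Definition cycle_bound (u : R * trajectory R) : \bar R :=
  (2%:E * trajectory_sup u.2 + (`|a| * `|u.1|)%:E)%E.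

Lemma measurable_drifted_end : measurable_fun setT drifted_end.
Proof.
apply: emeasurable_funB.
  by apply: measurableT_comp; [exact: measurable_trajectory_end|
    exact: measurable_snd].
apply/measurable_EFinP; exact: measurable_funM.
Qed.

Lemma measurable_cycle_bound : measurable_fun setT cycle_bound.
Proof.
apply: emeasurable_funD.
  apply: measurable_funeM.
  by apply: measurableT_comp; [exact: measurable_trajectory_sup|
    exact: measurable_snd].
apply/measurable_EFinP; apply: measurable_funM => //.
apply: measurableT_comp => //; exact: measurable_fst.
Qed.

Lemma cycle_bound_ge0 u : (0 <= cycle_bound u)%E.
Proof.
by rewrite adde_ge0 ?mule_ge0 ?trajectory_sup_ge0// lee_fin mulr_ge0.
Qed.

Lemma drifted_endE n w :
  drifted_end (X n w) = (drifted (T n.+1 w) w - drifted (T n w) w)%:E.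
Proof.
rewrite /drifted_end (stopped_increment_end (Z ^~ w)) -EFinB TS /drifted.
congr EFin; rewrite /=; ring.
Qed.

Lemma drifted_increment_le n w t : T n w <= t <= T n.+1 w ->
  (`|drifted t w - drifted (T n w) w|%:E <=
   trajectory_sup (X n w).2 + (`|a| * `|xi n w|)%:E)%E.
Proof.
rewrite TS => /andP[Tt tT].
have cz : cadlag (Z ^~ w) by case: Z_cadlag.
have t_itv : 0 <= t - T n w <= xi n w by apply/andP; split; lra.
have := stopped_increment_le_sup cz (T_ge0 n w) t_itv.
rewrite (addrC (T n w)) subrK => sup_le.
apply: le_trans (leeD2r _ sup_le); rewrite -EFinD lee_fin.
rewrite (_ : _ - _ = (Z t w - Z (T n w) w) - a * (t - T n w)); last first.
  by rewrite /drifted; ring.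
rewrite (le_trans (ler_normB _ _))// lerD2l normrM ler_wpM2l//.
by rewrite ler_norml; move: (ler_norm (xi n w)); case/andP: t_itv; lra.
Qed.

Lemma drifted_end_le n w :
  (`|drifted_end (X n w)| <= cycle_bound (X n w))%E.
Proof.
have T_itv : T n w <= T n.+1 w <= T n.+1 w.
  by rewrite lexx andbT TS lerDl ltW// step_gt0.
rewrite drifted_endE abse_EFin (le_trans (drifted_increment_le T_itv))//.
rewrite leeD2r// muleC -{1}[trajectory_sup _]mule1.
by rewrite lee_wpmul2l ?trajectory_sup_ge0// lee_fin; lra.
Qed.

Lemma drifted_last_cycle_le n w t : T n w <= t <= T n.+1 w ->
  (`|drifted t w - drifted (T n.+1 w) w|%:E <= cycle_bound (X n w))%E.
Proof.
rewrite TS => /andP[Tt tT].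
have cz : cadlag (Z ^~ w) by case: Z_cadlag.
have xi0 : 0 <= xi n w by exact: ltW (step_gt0 n w).
have t_itv : 0 <= t - T n w <= xi n w by apply/andP; split; lra.
have xi_itv : 0 <= xi n w <= xi n w by rewrite lexx andbT.
have := stopped_increment_le_sup cz (T_ge0 n w) t_itv.
have := stopped_increment_le_sup cz (T_ge0 n w) xi_itv.
rewrite (addrC (T n w) (t - _)) subrK => sup_xi sup_t.
apply: (@le_trans _ _ (`|Z t w - Z (T n w) w|%:E +
    `|Z (T n w + xi n w) w - Z (T n w) w|%:E + (`|a| * `|xi n w|)%:E)%E).
  rewrite -!EFinD lee_fin.
  rewrite (_ : _ - _ = (Z t w - Z (T n w) w) -
    (Z (T n w + xi n w) w - Z (T n w) w) - a * (t - T n w - xi n w)); last first.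
    by rewrite /drifted; ring.
  rewrite (le_trans (ler_normB _ _))// lerD ?ler_normB// normrM ler_wpM2l//.
  by rewrite (ger0_norm xi0) ler_norml; case/andP: t_itv; lra.
rewrite leeD2r//.
by rewrite (mule_natl _ 2) mule2n leeD.
Qed.

Lemma measurable_drifted t : 0 <= t -> measurable_fun setT (drifted t).
Proof.
move=> t0; apply: measurable_funB; last exact: measurable_cst.
by case: Z_cadlag => mZ _; exact: mZ.
Qed.

Lemma drifted0 w : drifted 0 w = 0.
Proof. by rewrite /drifted mulr0 subr0; case: Z_regenerative. Qed.

Lemma measurable_drifted_renewal n :
  measurable_fun setT (fun w => drifted (T n w) w).
Proof.
elim: n => [|n IH].
  rewrite (_ : (fun w => _) = cst 0); first exact: measurable_cst.
  by apply/funext => w; rewrite T0 drifted0.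
rewrite (_ : (fun w => _) =
    (fun w => drifted (T n w) w + fine (drifted_end (X n w)))); last first.
  by apply/funext => w; rewrite drifted_endE/= addrC subrK.
apply: measurable_funD => //; apply/measurable_EFinP.
rewrite (_ : EFin \o _ = drifted_end \o X n).
  exact: measurableT_comp measurable_drifted_end (mX n).
by apply/funext => w /=; rewrite fineK// drifted_endE.
Qed.

Let started t n : set Omega := T n @^-1` `]-oo, t].
Let running t n : set Omega := started t n `\` started t n.+1.

Let past_started t n : past X n (started t n).
Proof. exact: (past_renewal_time mstep (measurable_itv _)). Qed.

Let mstarted t n : measurable (started t n).
Proof. exact: (past_measurable X_iid (@past_started t n)). Qed.

Let mrunning t n : measurable (running t n).
Proof. exact: measurableD. Qed.

Let runningP t n w : running t n w -> T n w <= t <= T n.+1 w.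
Proof.
rewrite /running /started /= !in_itv/= => -[-> /negP]; rewrite -ltNge.
by move=> /ltW ->.
Qed.

Let eta n w := drifted (T n.+1 w) w - drifted (T n w) w.
Let last t n w := drifted t w - drifted (T n.+1 w) w.

Let in_started t n w : (w \in started t n) = (T n w <= t).
Proof.
apply/idP/idP; first by rewrite inE /started/= in_itv.
by move=> Tt; rewrite inE /started/= in_itv.
Qed.

Let T_le n w : T n w <= T n.+1 w.
Proof. by rewrite TS lerDl ltW// step_gt0. Qed.

(** The process stopped at [t] moves, during cycle [n], by the whole increment of
    the cycle if it starts before [t], corrected by the part that remains after
    [t] if [t] falls in the cycle.  The first term has mean zero. *)
Lemma drifted_stopped_step t n w :
  drifted (Num.min t (T n.+1 w)) w - drifted (Num.min t (T n w)) w =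
  (eta n \_ (started t n)) w + (last t n \_ (running t n)) w.
Proof.
rewrite !patchE /running in_setD !in_started /eta /last.
have [Tt|tT] := leP (T n w) t; last first.
  by rewrite (min_l (ltW (lt_le_trans tT (T_le n w)))) subrr addr0.
have [T't|tT'] := leP (T n.+1 w) t; first by rewrite /= addr0.
by rewrite /=; ring.
Qed.

Lemma drifted_stopped_step_le t n w :
  (`|drifted (Num.min t (T n.+1 w)) w - drifted (Num.min t (T n w)) w|%:E <=
   ((cycle_bound \o X n) \_ (started t n)) w)%E.
Proof.
rewrite patchE in_started; have [Tt|tT] := leP (T n w) t; last first.
  by rewrite (min_l (ltW (lt_le_trans tT (T_le n w)))) subrr normr0.
have min_itv : T n w <= Num.min t (T n.+1 w) <= T n.+1 w.
  by rewrite le_min Tt T_le ge_min lexx orbT.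
apply: le_trans (drifted_increment_le min_itv) _.
rewrite leeD2r// muleC -{1}[trajectory_sup _]mule1.
by rewrite lee_wpmul2l ?trajectory_sup_ge0// lee_fin; lra.
Qed.

Hypothesis cycle_bound_fin : (\int[P]_w cycle_bound (X 0%N w) < +oo)%E.
Hypothesis drifted_end_mean0 : (\int[P]_w drifted_end (X 0%N w) = 0)%E.

Lemma integrable_cycle_bound n :
  P.-integrable setT (fun w => cycle_bound (X n w)).
Proof.
apply/integrableP; split.
  exact: measurableT_comp measurable_cycle_bound (mX n).
under eq_integral do rewrite gee0_abs ?cycle_bound_ge0//.
rewrite (ge0_integral_iid X_iid n measurable_cycle_bound)//.
exact: cycle_bound_ge0.
Qed.

Lemma integrable_drifted_end n :
  P.-integrable setT (fun w => drifted_end (X n w)).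
Proof.
apply: le_integrable (integrable_cycle_bound n) => //.
  exact: measurableT_comp measurable_drifted_end (mX n).
move=> w _; rewrite (gee0_abs (cycle_bound_ge0 _)); exact: drifted_end_le.
Qed.

(** Whether cycle [n] starts before time [t] is decided before that cycle, so
    the cycle contributes mean zero. *)
Lemma mean_started t n :
  (\int[P]_(w in started t n) (eta n w)%:E = 0)%E.
Proof.
under eq_integral do rewrite /eta -drifted_endE.
rewrite (integral_past X_iid (@past_started t n) measurable_drifted_end).
  by rewrite drifted_end_mean0 mule0.
exact: integrable_drifted_end.
Qed.

Lemma mean_running_le t n : 0 <= t ->
  P.-integrable (running t n) (EFin \o last t n) /\
  (`|\int[P]_(w in running t n) (last t n w)%:E| <=
    \int[P]_(w in running t n) cycle_bound (X n w))%E.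
Proof.
move=> t0.
have mlast : measurable_fun (running t n) (EFin \o last t n).
  apply/measurable_EFinP; apply: measurable_funTS; apply: measurable_funB.
    exact: measurable_drifted.
  exact: measurable_drifted_renewal.
have W_int := integrableS measurableT (mrunning t n) (@subsetT _ _)
  (integrable_cycle_bound n).
have last_le w : running t n w ->
    (`|(last t n w)%:E| <= cycle_bound (X n w))%E.
  by move=> /runningP; exact: drifted_last_cycle_le.
split.
  apply: le_integrable W_int => // w /last_le.
  by rewrite (gee0_abs (cycle_bound_ge0 _)).
apply: le_trans (le_abse_integral _ _ mlast) _ => //.
apply: ge0_le_integral => //.
- exact: measurableT_comp.
- exact: measurable_int W_int.
Qed.

Lemma mean_stopped_le t N : 0 <= t ->
  P.-integrable setT (fun w => (drifted (Num.min t (T N w)) w)%:E) /\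
  (`|\int[P]_w (drifted (Num.min t (T N w)) w)%:E| <=
    \sum_(n < N) \int[P]_(w in running t n) cycle_bound (X n w))%E.
Proof.
move=> t0; elim: N => [|N [IH_int IH]].
  have start0 : (fun w => (drifted (Num.min t (T 0 w)) w)%:E) = cst 0%E.
    by apply/funext => w; rewrite T0 min_r// drifted0.
  rewrite start0 integral0 abse0 big_ord0; split=> //; exact: integrable0.
have [last_int last_le] := mean_running_le N t0.
have eta_int : P.-integrable setT (EFin \o (eta N \_ (started t N))).
  rewrite -restrict_EFin; apply/(integrable_mkcond _ (mstarted t N)).
  have := integrableS measurableT (mstarted t N) (@subsetT _ _)
    (integrable_drifted_end N).
  rewrite (_ : (fun w => drifted_end (X N w)) = EFin \o eta N)//.
  by apply/funext => w; rewrite drifted_endE.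
have lastT_int : P.-integrable setT (EFin \o (last t N \_ (running t N))).
  by rewrite -restrict_EFin; apply/(integrable_mkcond _ (mrunning t N)).
have stepE w : drifted (Num.min t (T N.+1 w)) w =
    drifted (Num.min t (T N w)) w +
      ((eta N \_ (started t N)) w + (last t N \_ (running t N)) w).
  by rewrite -drifted_stopped_step addrC subrK.
have step_int : P.-integrable setT (fun w =>
    ((eta N \_ (started t N)) w + (last t N \_ (running t N)) w)%:E).
  exact: (integrableD measurableT eta_int lastT_int).
split.
  under eq_fun do rewrite stepE EFinD.
  exact: (integrableD measurableT IH_int step_int).
under eq_integral do rewrite stepE EFinD.
rewrite (integralD measurableT IH_int step_int).
under [X in (_ + X)%E]eq_integral do rewrite EFinD.
rewrite (integralD measurableT eta_int lastT_int).
rewrite -restrict_EFin -integral_mkcond mean_started add0e.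
rewrite -restrict_EFin -integral_mkcond big_ord_recr/=.
by rewrite (le_trans (lee_abs_add _ _))// leeD.
Qed.

Let startedP t n w : started t n w -> T n w <= t.
Proof. by rewrite -in_started inE. Qed.

Let marks_le := @expected_marks_le _ _ _ _ _ P X step X_iid mstep step_gt0.

(** Borel-Cantelli: the expected number of renewals up to [t] is finite. *)
Lemma renewals_finite e C t : 0 < e ->
  (forall s, (\sum_(n <oo) P (T n @^-1` `]s, (s + e)%R]) <= C%:E)%E) ->
  P.-negligible [set w | forall n, started t n w].
Proof.
move=> e0 UC.
have sum_fin : (\sum_(n <oo) P (started t n) < +oo)%E.
  have one_fin : (\int[P]_w cst 1 (X 0%N w) < +oo)%E.
    by rewrite integral_cst// mul1e ltey_eq fin_num_measure.
  have := marks_le e0 UC (@measurable_cst _ _ _ _ setT 1%E) (fun=> lee01)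
    (fun=> @measurable_cst _ _ _ _ setT 1%E) (fun _ _ => lee01)
    (fun=> one_fin) (mstarted t).
  rewrite (_ : (\sum_(n <oo) \int[P]_(w in started t n) cst 1 (X n w))%E =
    (\sum_(n <oo) P (started t n))%E); last first.
    apply: eq_eseriesr => n _; rewrite -[RHS]mul1e.
    exact: (integral_cst P (mstarted t n) 1%E).
  move=> sum_le; apply: le_lt_trans
    (sum_le t (startedP (t := t)) (fun _ _ _ _ _ => lexx _)) _.
  rewrite ltey_eq fin_numM//; apply/sum_fin_numP => k _ _.
  by rewrite ge0_fin_numE// integral_ge0.
exists (lim_sup_set (started t)); split.
- apply: bigcap_measurableType => n _.
  by apply: bigcup_measurable => k _; exact: mstarted.
- exact: (@lim_sup_set_cvg0 _ _ _ P (started t) (mstarted t) sum_fin).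
- by move=> w tw n _; exists n => //=.
Qed.

(** The process stopped at time [min t (T N)] satisfies the bound for every [N],
    coincides with [drifted t] once [T N] exceeds [t], and is dominated by the sum
    of the bounds of all cycles that start before [t]. *)
Lemma drifted_mean_le e C t : 0 < e ->
  (forall s, (\sum_(n <oo) P (T n @^-1` `]s, (s + e)%R]) <= C%:E)%E) ->
  0 <= t ->
  P.-integrable setT (EFin \o drifted t) /\
  (`|\int[P]_w (drifted t w)%:E| <=
    C%:E * \sum_(k < (Num.truncn (t / e)).+1)
      \int[P]_(w in [set w | (k%:R * e < xi 0%N w)%R]) cycle_bound (X 0%N w))%E.
Proof.
move=> e0 UC t0.
pose W n := (cycle_bound \o X n) \_ (started t n).
have W0 n w : (0 <= W n w)%E.
  by rewrite /W patchE; case: ifP => // _; exact: cycle_bound_ge0.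
have mW n : measurable_fun setT (W n).
  apply/(measurable_restrictT _ (mstarted t n)); apply: measurable_funTS.
  exact: measurableT_comp measurable_cycle_bound (mX n).
pose G w := (\sum_(n <oo) W n w)%E.
have G_int : P.-integrable setT G.
  apply/integrableP; split.
    exact: (@ge0_emeasurable_sum _ _ _ setT W xpredT (fun n w _ _ => W0 n w)
      (fun n _ => mW n)).
  under eq_integral do rewrite gee0_abs ?nneseries_ge0//.
  rewrite integral_nneseries//.
  under eq_eseriesr do rewrite -integral_mkcond.
  have sum_le := marks_le e0 UC measurable_cycle_bound cycle_bound_ge0
    (fun=> measurable_cycle_bound) (fun=> cycle_bound_ge0)
    (fun=> cycle_bound_fin) (mstarted t).
  apply: le_lt_trans
    (sum_le t (startedP (t := t)) (fun _ _ _ _ _ => lexx _)) _.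
  rewrite ltey_eq fin_numM//; apply/sum_fin_numP => k _ _.
  rewrite ge0_fin_numE//; apply: integral_ge0 => w _.
  exact: cycle_bound_ge0.
have stopped_le N w : (`|(drifted (Num.min t (T N w)) w)%:E| <= G w)%E.
  apply: (@le_trans _ _ (\sum_(n < N) W n w)%E); last first.
    by rewrite -(big_mkord xpredT (W ^~ w)); exact: nneseries_lim_ge.
  elim: N => [|N IH].
    by rewrite T0 min_r// drifted0 abse0 big_ord0.
  rewrite big_ord_recr/=.
  apply: le_trans (leeD IH (drifted_stopped_step_le t N w)).
  rewrite abse_EFin -EFinD lee_fin.
  set y := drifted (Num.min t (T N w)) w.
  by rewrite -{1}(subrK y (drifted _ _)) addrC ler_normD.
have stopped_cvg : {ae P, forall w, setT w ->
    (drifted (Num.min t (T N w)) w)%:E @[N --> \oo] --> (drifted t w)%:E}.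
  have [N0 [mN0 PN0 subN0]] := renewals_finite t e0 UC.
  exists N0; split=> // w /= not_cvg; apply: subN0 => n.
  apply: contrapT => not_started; apply: not_cvg => _.
  apply: cvg_near_cst; near=> N; rewrite min_l//.
  have nN : (n <= N)%N by near: N; exact: nbhs_infty_ge.
  rewrite (le_trans _ (renewal_time_homo step_gt0 w nN))// ltW//.
  by rewrite ltNge -in_started; apply/negP; rewrite inE.
have stopped_int N := (mean_stopped_le N t0).1.
have mstopped N := measurable_int _ (stopped_int N).
have mdrifted : measurable_fun setT (EFin \o drifted t).
  by apply/measurable_EFinP; exact: measurable_drifted.
have [t_int _ mean_cvg] := @dominated_convergence _ _ _ P setT measurableT
  _ _ G mstopped mdrifted stopped_cvg G_int
  (aeW P (fun w N _ => stopped_le N w)).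
split=> //.
have abs_cvg : (`|\int[P]_w (drifted (Num.min t (T N w)) w)%:E|)%E @[N --> \oo]
    --> (`|\int[P]_w (drifted t w)%:E|)%E.
  exact: cvg_abse.
rewrite -(cvg_lim _ abs_cvg)//; apply: lime_le.
  by apply/cvg_ex; exists (`|\int[P]_w (drifted t w)%:E|)%E.
near=> N; apply: le_trans (mean_stopped_le N t0).2 _.
rewrite -(big_mkord xpredT (fun n =>
  \int[P]_(w in running t n) cycle_bound (X n w))%E).
apply: (@le_trans _ _
  (\sum_(n <oo) \int[P]_(w in running t n) cycle_bound (X n w))%E).
  apply: nneseries_lim_ge => n _ _.
  by apply: integral_ge0 => w _; exact: cycle_bound_ge0.
pose long k : set (R * trajectory R) := [set u | (k%:R * e < u.1)%R].
have mlong k : measurable (long k).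
  rewrite (_ : long k = step @^-1` `]k%:R * e, +oo[).
    by rewrite -[X in measurable X]setTI; exact: mstep.
  by apply/seteqP; split=> u; rewrite /long/= in_itv/= andbT.
have g0 k u : (0 <= (cycle_bound \_ (long k)) u)%E.
  by rewrite patchE; case: ifP => // _; exact: cycle_bound_ge0.
have gE k w : ((cycle_bound \_ (long k)) (X 0%N w))%E =
    ((fun w => cycle_bound (X 0%N w)) \_ [set w | (k%:R * e < xi 0%N w)%R]) w.
  by rewrite !patchE; congr (if _ then _ else _); apply/idP/idP; rewrite !inE.
have mg k : measurable_fun setT (cycle_bound \_ (long k)).
  apply/(measurable_restrictT _ (mlong k)); apply: measurable_funTS.
  exact: measurable_cycle_bound.
have g_fin k : (\int[P]_w (cycle_bound \_ (long k)) (X 0%N w) < +oo)%E.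
  apply: le_lt_trans cycle_bound_fin; apply: ge0_le_integral => //.
  - exact: measurableT_comp (mg k) (mX 0%N).
  - exact: measurableT_comp measurable_cycle_bound (mX 0%N).
  move=> w _; rewrite patchE; case: ifP => // _; exact: cycle_bound_ge0.
have := marks_le e0 UC measurable_cycle_bound cycle_bound_ge0 mg g0 g_fin
  (mrunning t) (t := t).
under [X in _ -> _ -> (_ <= _ * X)%E]eq_bigr => k _.
  under eq_integral do rewrite gE.
  rewrite -integral_mkcond.
  over.
apply.
- by move=> n w /runningP/andP[].
- move=> n k w running_w le_k; rewrite patchE mem_set//= /long/=.
  apply: le_lt_trans le_k _; rewrite ltrBlDl -TS ltNge -in_started.
  by apply/negP; rewrite inE; exact: running_w.2.
Unshelve. all: by end_near. Qed.

End regenerative_process.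

(** * Long cycles *)

Section moment_bound.
Variable R : realType.
Implicit Types (e x A r : R).

Let count e x K : R := \sum_(k < K) (k%:R * e < x)%R%:R.

Let count_le_size e x K : count e x K <= K%:R.
Proof.
rewrite -[X in _ <= X%:R](card_ord K) -sum1_card natr_sum.
by apply: ler_sum => k _; case: ltP.
Qed.

Let count_le_ratio e x K : 0 < e -> 0 < x -> count e x K <= 1 + x / e.
Proof.
move=> e0 x0; elim: K => [|K IH].
  by rewrite /count big_ord0 addr_ge0// divr_ge0// ltW.
have [Kx|xK] := ltP (K%:R * e) x; last first.
  by rewrite /count big_ord_recr/= ltNge xK addr0.
rewrite (le_trans (count_le_size _ _ _))// -natr1 addrC lerD2l.
by rewrite ler_pdivlMr// ltW.
Qed.

(** The left-hand side is at most [K] and at most [1 + x / e], and the minimum of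
    two numbers is at most their geometric mean with weights [r] and [1 - r].  The
    threshold [A] confines this mean, of order [K ^ r], to large values of [x]. *)
Lemma count_multiples_le e x A r (K : nat) : 0 < e -> 0 < x -> 0 <= A ->
  0 < r <= 1 ->
  \sum_(k < K) (k%:R * e < x)%R%:R <=
  1 + A / e + (A < x)%R%:R * (K%:R `^ r * (x / e) `^ (1 - r)).
Proof.
move=> e0 x0 A0 /andP[r0 r1]; rewrite -/(count e x K).
have A0e : 0 <= A / e by rewrite divr_ge0// ltW.
have x0e : 0 <= x / e by rewrite divr_ge0// ltW.
have [Ax|xA] := ltP A x; last first.
  rewrite mul0r addr0 (le_trans (count_le_ratio _ e0 x0))// lerD2l.
  by rewrite ler_pM2r// invr_gt0.
have powR_split y : 0 <= y -> y = y `^ r * y `^ (1 - r).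
  by move=> y0; rewrite -powRD subrKC ?powRr1// oner_eq0.
have r1' : 0 <= 1 - r by rewrite subr_ge0.
rewrite mul1r; have [Ky|yK] := leP K%:R (x / e).
  rewrite (le_trans (count_le_size _ _ _))// {1}(powR_split K%:R)//.
  apply: ler_wpDl; first exact: addr_ge0.
  by rewrite ler_wpM2l ?powR_ge0// ge0_ler_powR// nnegrE.
rewrite (le_trans (count_le_ratio _ e0 x0))// -addrA lerD2l.
rewrite {1}(powR_split (x / e))//; apply: ler_wpDl => //.
by rewrite ler_wpM2r ?powR_ge0// ge0_ler_powR ?nnegrE// ltW.
Qed.

End moment_bound.

Section long_cycles.
Context {d : measure_display} {Omega : measurableType d} {R : realType}.
Variables (P : probability Omega R) (xi W : Omega -> R) (r : R).
Hypothesis r_itv : 0 < r <= 1.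
Hypothesis mxi : measurable_fun setT xi.
Hypothesis mW : measurable_fun setT W.
Hypothesis xi_gt0 : forall w, 0 < xi w.
Hypothesis W_ge0 : forall w, 0 <= W w.
Hypothesis W_fin : (\int[P]_w (W w)%:E < +oo)%E.
Hypothesis Wxi_fin : (\int[P]_w (W w * xi w `^ (1 - r))%:E < +oo)%E.

Let mlonger (c : R) : measurable [set w | c < xi w].
Proof.
rewrite (_ : [set w | _] = xi @^-1` `]c, +oo[).
  by rewrite -[X in measurable X]setTI; exact: mxi.
by apply/seteqP; split=> w; rewrite /= in_itv/= andbT.
Qed.

Let mWxi : measurable_fun setT (fun w => W w * xi w `^ (1 - r)).
Proof.
apply: measurable_funM => //.
exact: measurableT_comp (measurable_powR (1 - r)) mxi.
Qed.

Let Wxi_ge0 w : 0 <= W w * xi w `^ (1 - r).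
Proof. by rewrite mulr_ge0// powR_ge0. Qed.

Lemma tail_moment_small (eps : R) : 0 < eps -> exists N : nat,
  (\int[P]_(w in [set w | (N%:R < xi w)%R]) (W w * xi w `^ (1 - r))%:E <= eps%:E)%E.
Proof.
move=> eps0; pose V w := (W w * xi w `^ (1 - r))%:E.
have mV : measurable_fun setT V by exact/measurable_EFinP.
pose f N := V \_ [set w | N%:R < xi w].
have mf N : measurable_fun setT (f N).
  by apply/(measurable_restrictT _ (mlonger _)); exact: measurable_funTS.
have V_int : P.-integrable setT V.
  apply/integrableP; split=> //.
  by under eq_integral do rewrite gee0_abs ?lee_fin//.
have f_cvg : {ae P, forall w, setT w -> f ^~ w @ \oo --> cst 0%E w}.
  apply: aeW => w _; apply: cvg_near_cst; near=> N.
  rewrite /f patchE memNset//= => /lt_geF/negP; apply.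
  by near: N; exact: nbhs_infty_ger.
have f_le : {ae P, forall w N, setT w -> (`|f N w| <= V w)%E}.
  apply: aeW => w N _; rewrite /f patchE; case: ifP => _.
    by rewrite gee0_abs// lee_fin.
  by rewrite abse0 lee_fin.
have [_ _] := dominated_convergence measurableT mf
  (@measurable_cst _ _ _ _ setT 0%E) f_cvg V_int f_le.
rewrite integral0 => /fine_cvgP[f_fin /cvgr_lt/(_ _ eps0) f_lt].
have [N [N_fin N_lt]] := filter_ex (filterI f_fin f_lt).
exists N; rewrite integral_mkcond -[leLHS]fineK// lee_fin ltW//.
Unshelve. all: by end_near. Qed.

(** The sum is the mean of [W] times the number of multiples of [e] below [xi].  In
    the bound for that number, the term of order [t ^ r] contributes a tail of the
    integral of [W * xi ^ (1 - r)], which a high threshold makes small. *)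
Lemma long_cycles_littleo (e eps : R) : 0 < e -> 0 < eps ->
  exists t0 : R, forall t, t0 <= t ->
    (\sum_(k < (Num.truncn (t / e)).+1)
      \int[P]_(w in [set w | (k%:R * e < xi w)%R]) (W w)%:E <=
    (eps * t `^ r)%:E)%E.
Proof.
move=> e0 eps0; have /andP[r0 r1] := r_itv.
(* [c * t ^ r] bounds the coefficient of the tail moment, as the sum has at most
   [2 * t / e] terms when [e <= t]. *)
pose c := (2 / e) `^ r * e^-1 `^ (1 - r).
have c0 : 0 < c by rewrite mulr_gt0// powR_gt0// ?invr_gt0 ?divr_gt0.
have [N tail_le] := @tail_moment_small (eps / 2 / c) ltac:(by rewrite !divr_gt0).
pose w0 := fine (\int[P]_w (W w)%:E).
have W_fin_num : (\int[P]_w (W w)%:E)%E \is a fin_num.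
  by rewrite ge0_fin_numE// integral_ge0// => w _; rewrite lee_fin.
have w0_ge0 : 0 <= w0 by rewrite fine_ge0// integral_ge0// => w _; rewrite lee_fin.
pose b := (1 + N%:R / e) * w0.
have b0 : 0 <= b by rewrite mulr_ge0// addr_ge0// divr_ge0// ltW.
(* The second lower bound on [t] makes [b <= eps / 2 * t ^ r]. *)
exists (Num.max e ((2 * b / eps) `^ r^-1)) => t; rewrite ge_max => /andP[et tb].
set K := (Num.truncn (t / e)).+1.
have t0 : 0 < t by exact: lt_le_trans et.
have K_le : K%:R <= 2 / e * t.
  have te : 1 <= t / e by rewrite ler_pdivlMr// mul1r.
  have trunc_le : (Num.truncn (t / e))%:R <= t / e.
    by rewrite truncn_le (le_trans ler01 te).
  by rewrite /K -natr1 (_ : 2 / e * t = 2 * (t / e)); [lra|ring].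
have b_le : b <= eps / 2 * t `^ r.
  have : (2 * b / eps) `^ r^-1 `^ r <= t `^ r.
    by rewrite ge0_ler_powR ?nnegrE ?powR_ge0// ?ltW//.
  rewrite -powRrM mulVf ?gt_eqF// powRr1; last first.
    by apply: divr_ge0; [exact: mulr_ge0|exact: ltW].
  by rewrite ler_pdivrMr//; lra.
pose L k := [set w | k%:R * e < xi w].
pose Tail := [set w | N%:R < xi w].
have mtail : measurable_fun setT
    ((fun w => (W w * xi w `^ (1 - r))%:E) \_ Tail).
  apply/(measurable_restrictT _ (mlonger _)); apply: measurable_funTS.
  exact/measurable_EFinP.
have tail0 w : (0 <= ((fun w => (W w * xi w `^ (1 - r))%:E) \_ Tail) w)%E.
  by rewrite patchE; case: ifP => // _; rewrite lee_fin.
have kc0 : 0 <= K%:R `^ r * e^-1 `^ (1 - r) by rewrite mulr_ge0// powR_ge0.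
apply: (@le_trans _ _ (\int[P]_w ((1 + N%:R / e)%:E * (W w)%:E +
    (K%:R `^ r * e^-1 `^ (1 - r))%:E *
      ((fun w => (W w * xi w `^ (1 - r))%:E) \_ Tail) w))%E).
  under eq_bigr do rewrite integral_mkcond.
  rewrite -ge0_integral_sum//; last 2 first.
  - move=> k; apply/(measurable_restrictT _ (mlonger _)); apply: measurable_funTS.
    exact/measurable_EFinP.
  - by move=> k w _; rewrite patchE; case: ifP => // _; rewrite lee_fin.
  apply: ge0_le_integral => //.
  - move=> w _; apply: sume_ge0 => k _.
    by rewrite patchE; case: ifP => // _; rewrite lee_fin.
  - apply: emeasurable_sum => k.
    apply/(measurable_restrictT _ (mlonger _)); apply: measurable_funTS.
    exact/measurable_EFinP.
  - apply: emeasurable_funD; apply: measurable_funeM => //.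
    exact/measurable_EFinP.
  move=> w _.
  have -> : (\sum_(k < K) ((fun w => (W w)%:E) \_ (L k)) w)%E =
      (W w * \sum_(k < K) (k%:R * e < xi w)%R%:R)%:E.
    rewrite mulr_sumr -sumEFin; apply: eq_bigr => k _; rewrite patchE.
    have -> : (w \in L k) = (k%:R * e < xi w) by apply/idP/idP; rewrite inE.
    by case: ltP => _; rewrite ?mulr1 ?mulr0.
  have -> : ((fun w => (W w * xi w `^ (1 - r))%:E) \_ Tail) w =
      ((N%:R < xi w)%R%:R * (W w * xi w `^ (1 - r)))%:E.
    rewrite patchE.
    have -> : (w \in Tail) = (N%:R < xi w) by apply/idP/idP; rewrite inE.
    by case: ltP => _; rewrite ?mul1r ?mul0r.
  rewrite -!EFinM -EFinD lee_fin.
  have := count_multiples_le K e0 (xi_gt0 w) (ler0n R N) r_itv.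
  move=> /(ler_wpM2l (W_ge0 w)) /le_trans; apply.
  rewrite powRM ?invr_ge0 ?(ltW e0) ?(ltW (xi_gt0 w))//.
  by rewrite le_eqVlt; apply/orP; left; apply/eqP; ring.
rewrite ge0_integralD//; last 4 first.
- by move=> w _; rewrite -EFinM lee_fin mulr_ge0// addr_ge0// divr_ge0// ltW.
- by apply: measurable_funeM; exact/measurable_EFinP.
- by move=> w _; rewrite mule_ge0// lee_fin.
- exact: measurable_funeM.
rewrite !ge0_integralZl//; last 3 first.
- exact/measurable_EFinP.
- by move=> w _; rewrite lee_fin.
- by rewrite lee_fin addr_ge0// divr_ge0// ltW.
rewrite -integral_mkcond -[X in (_ * X + _)%E]fineK// -EFinM.
apply: (@le_trans _ _
  (b%:E + (K%:R `^ r * e^-1 `^ (1 - r))%:E * (eps / 2 / c)%:E)%E).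
  by rewrite leeD2l// lee_wpmul2l// lee_fin.
rewrite -EFinM -EFinD lee_fin.
have K_pow : K%:R `^ r <= (2 / e) `^ r * t `^ r.
  rewrite -powRM ?divr_ge0 ?(ltW e0) ?(ltW t0)//.
  by rewrite ge0_ler_powR ?nnegrE ?mulr_ge0 ?invr_ge0 ?(ltW e0) ?(ltW t0) ?(ltW r0).
have : K%:R `^ r * e^-1 `^ (1 - r) * (eps / 2 / c) <= eps / 2 * t `^ r.
  apply: (@le_trans _ _ ((2 / e) `^ r * t `^ r * e^-1 `^ (1 - r) * (eps / 2 / c))).
    by rewrite ler_pM2r ?divr_gt0// ler_wpM2r// powR_ge0.
  rewrite le_eqVlt; apply/orP; left; apply/eqP; rewrite /c; field.
  by rewrite !gt_eqF// powR_gt0// ?invr_gt0// divr_gt0.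
lra.
Qed.

End long_cycles.

(** * Finite means *)

Section finite_means.
Context {d : measure_display} {Omega : measurableType d} {R : realType}.
Variable P : probability Omega R.
Implicit Types V : Omega -> R.

Lemma finite_mean_le V V' : measurable_fun setT V ->
  measurable_fun setT V' -> (forall w, 0 <= V w <= V' w) ->
  (\int[P]_w (V' w)%:E < +oo)%E -> (\int[P]_w (V w)%:E < +oo)%E.
Proof.
move=> mV mV' VV'; apply: le_lt_trans; apply: ge0_le_integral => //.
- by move=> w _; rewrite lee_fin; case/andP: (VV' w).
- exact/measurable_EFinP.
- exact/measurable_EFinP.
- by move=> w _; rewrite lee_fin; case/andP: (VV' w).
Qed.

Lemma finite_mean_comb V V' (b b' : R) :
  measurable_fun setT V -> measurable_fun setT V' ->
  (forall w, 0 <= V w) -> (forall w, 0 <= V' w) -> 0 <= b -> 0 <= b' ->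
  (\int[P]_w (V w)%:E < +oo)%E -> (\int[P]_w (V' w)%:E < +oo)%E ->
  (\int[P]_w (b * V w + b' * V' w)%:E < +oo)%E.
Proof.
move=> mV mV' V0 V'0 b0 b'0 V_fin V'_fin.
have int_fin (U : Omega -> R) : measurable_fun setT U -> (forall w, 0 <= U w) ->
    (\int[P]_w (U w)%:E < +oo)%E -> P.-integrable setT (EFin \o U).
  move=> mU U0 U_fin; apply/integrableP; split; first exact/measurable_EFinP.
  by under eq_integral do rewrite gee0_abs ?lee_fin ?U0//.
have := integrableD measurableT
  (integrableZl measurableT b (int_fin V mV V0 V_fin))
  (integrableZl measurableT b' (int_fin V' mV' V'0 V'_fin)).
by move=> /(integrable_lty measurableT).
Qed.

Lemma finite_mean_cst (b : R) : (\int[P]_w b%:E < +oo)%E.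
Proof.
by rewrite integral_cst// ltey_eq fin_numM// fin_num_measure.
Qed.

(** [V ^ p <= 1 + V ^ q]. *)
Lemma finite_mean_pow V (p q : R) : measurable_fun setT V ->
  (forall w, 0 <= V w) -> 0 <= p <= q ->
  (\int[P]_w (V w `^ q)%:E < +oo)%E -> (\int[P]_w (V w `^ p)%:E < +oo)%E.
Proof.
move=> mV V0 /andP[p0 pq] Vq_fin.
have mpow s : measurable_fun setT (fun w => V w `^ s).
  exact: measurableT_comp (measurable_powR s) mV.
apply: (@finite_mean_le _ (fun w => 1 * cst 1 w + 1 * (V w `^ q))) => //.
- by apply: measurable_funD; apply: measurable_funM.
- move=> w; rewrite powR_ge0/= !mul1r; have [V1|V1] := leP (V w) 1.
    have : V w `^ p <= 1 `^ p by rewrite ge0_ler_powR// nnegrE.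
    by rewrite powR1 => /le_trans; apply; rewrite lerDl powR_ge0.
  by rewrite (le_trans (ler_powR (ltW V1) pq))// lerDr.
- apply: finite_mean_comb => //; first by move=> w; exact: powR_ge0.
  exact: finite_mean_cst.
Qed.

(** Young's inequality. *)
Lemma finite_mean_mul V V' (s q : R) :
  measurable_fun setT V -> measurable_fun setT V' ->
  (forall w, 0 <= V w) -> (forall w, 0 <= V' w) ->
  0 < s -> 0 < q -> s^-1 + q^-1 = 1 ->
  (\int[P]_w (V w `^ s)%:E < +oo)%E -> (\int[P]_w (V' w `^ q)%:E < +oo)%E ->
  (\int[P]_w (V w * V' w)%:E < +oo)%E.
Proof.
move=> mV mV' V0 V'0 s0 q0 sq V_fin V'_fin.
have mpow (U : Omega -> R) t : measurable_fun setT U ->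
    measurable_fun setT (fun w => U w `^ t).
  by move=> mU; exact: measurableT_comp (measurable_powR t) mU.
apply: (@finite_mean_le _ (fun w => s^-1 * (V w `^ s) + q^-1 * (V' w `^ q))).
- exact: measurable_funM.
- by apply: measurable_funD; apply: measurable_funM => //; exact: mpow.
- move=> w; rewrite mulr_ge0//=.
  by rewrite [s^-1 * _]mulrC [q^-1 * _]mulrC conjugate_powR.
- apply: finite_mean_comb => //; do ?[exact: mpow].
  + by move=> w; exact: powR_ge0.
  + by move=> w; exact: powR_ge0.
  + by rewrite invr_ge0 ltW.
  + by rewrite invr_ge0 ltW.
Qed.

End finite_means.

(** * Moments of the first cycle *)

Section first_cycle_moments.
Context {d : measure_display} {Omega : measurableType d} {R : realType}.
Variables (P : probability Omega R) (xi : nat -> Omega -> R)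
  (Z : R -> Omega -> R).
Hypothesis xi_renewal : renewal_steps P xi.
Hypothesis Z_cadlag : cadlag_process Z.
Hypothesis Z_regenerative : regenerative_increments P xi Z.

Local Notation X := (increment xi Z).
Local Notation T1 := (renewal_time xi 1).
Local Notation M1 := (sup_first_cycle xi Z).
Local Notation a := (mean_drift P xi Z).

Let T1E w : T1 w = xi 0%N w.
Proof. by rewrite /renewal_time big_ord1. Qed.

Let T1_gt0 w : 0 < T1 w.
Proof. by rewrite T1E; exact: (xi_renewal.2 0%N w). Qed.

Let mX0 : measurable_fun setT (X 0%N).
Proof. by case: Z_regenerative => _ []. Qed.

Let mT1 : measurable_fun setT T1.
Proof.
rewrite (_ : T1 = fst \o X 0%N); first exact: measurableT_comp.
by apply/funext => w; rewrite T1E.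
Qed.

(** A supremum over uncountably many times becomes a measurable one. *)
Lemma sup_first_cycleE w : (M1 w)%:E = trajectory_sup (X 0%N w).2.
Proof.
rewrite /sup_first_cycle T1E.
rewrite -(@trajectory_sup_first _ (Z ^~ w) (xi 0%N w)).
- by rewrite /increment/= [renewal_time xi 0 w]big_ord0.
- by case: Z_cadlag.
- by case: Z_regenerative.
- by rewrite -T1E ltW.
Qed.

Let M1_ge0 w : 0 <= M1 w.
Proof. by rewrite -lee_fin sup_first_cycleE trajectory_sup_ge0. Qed.

Let mM1 : measurable_fun setT M1.
Proof.
apply/measurable_EFinP.
rewrite (_ : EFin \o M1 = @trajectory_sup R \o (snd \o X 0%N)).
  apply: measurableT_comp; first exact: measurable_trajectory_sup.
  exact: measurableT_comp.
by apply/funext => w; rewrite /= sup_first_cycleE.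
Qed.

Let mT1_pow p : measurable_fun setT (fun w => T1 w `^ p).
Proof. exact: measurableT_comp (measurable_powR p) mT1. Qed.

Let T1_fin r : 0 < r <= 1 ->
  (\int[P]_w (T1 w `^ (2 - r))%:E < +oo)%E -> (\int[P]_w (T1 w)%:E < +oo)%E.
Proof.
move=> /andP[r0 r1] Tp_fin.
have T1_ge0 w : 0 <= T1 w by exact: ltW.
under eq_integral do rewrite -[T1 _]powRr1//.
by apply: finite_mean_pow Tp_fin => //; apply/andP; split; lra.
Qed.

(** The drift is the ratio of the two means that are subtracted here. *)
Lemma drifted_end_mean :
  (\int[P]_w (T1 w)%:E < +oo)%E -> (\int[P]_w (M1 w)%:E < +oo)%E ->
  (\int[P]_w drifted_end a (X 0%N w) = 0)%E.
Proof.
move=> T_fin M_fin; pose Z1 w := Z (T1 w) w.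
have T0 w : renewal_time xi 0 w = 0 by rewrite /renewal_time big_ord0.
have mZ1 : measurable_fun setT Z1.
  rewrite (_ : Z1 = fun w => drifted Z 0 (T1 w) w).
    exact: (measurable_drifted_renewal Z_regenerative 0 1).
  by apply/funext => w; rewrite /drifted mul0r subr0.
have int_T1 : P.-integrable setT (EFin \o T1).
  apply/integrableP; split; first exact/measurable_EFinP.
  by under eq_integral do rewrite gee0_abs ?lee_fin ?(ltW (T1_gt0 _))//.
have int_Z1 : P.-integrable setT (EFin \o Z1).
  apply/integrableP; split; first exact/measurable_EFinP.
  apply: le_lt_trans M_fin; apply: ge0_le_integral => //.
  - apply: measurableT_comp => //; exact/measurable_EFinP.
  - exact/measurable_EFinP.
  move=> w _; rewrite abse_EFin sup_first_cycleE.
  rewrite (_ : (X 0%N w).2 = stopped_increment (Z ^~ w) 0 (xi 0%N w)); last first.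
    by rewrite /increment/= T0.
  have xi_itv : 0 <= xi 0%N w <= xi 0%N w by rewrite lexx -T1E ltW.
  have := stopped_increment_le_sup (Z_cadlag.2 w) (lexx 0) xi_itv.
  by rewrite add0r (Z_regenerative.1 w) subr0 /Z1 T1E.
have T_fin_num : (\int[P]_w (T1 w)%:E)%E \is a fin_num.
  exact: integrable_fin_num.
(* The denominator of the drift: a positive variable has a nonzero mean. *)
have mean_T1 : fine (\int[P]_w (T1 w)%:E) != 0.
  apply/eqP => mean_T1_0.
  have : (\int[P]_w `|(EFin \o T1) w| = 0)%E.
    under eq_integral do rewrite gee0_abs ?lee_fin ?(ltW (T1_gt0 _))//.
    by rewrite -(fineK T_fin_num) mean_T1_0.
  move/(ae_eq_integral_abs P measurableT (measurable_int _ int_T1)).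
  move=> [N [mN PN subN]].
  have : P setT = 0%E.
    apply: (subset_measure0 measurableT mN _ PN) => w _; apply: subN => /=.
    by move=> /(_ I) [T1_0]; have := T1_gt0 w; rewrite T1_0 ltxx.
  by rewrite probability_setT => /eqP; rewrite onee_eq0.
under eq_integral.
  move=> w _.
  rewrite drifted_endE T0.
  rewrite (drifted0 Z_regenerative) subr0 /drifted EFinB EFinM.
  over.
rewrite integralB//; last exact: integrableZl.
rewrite integralZl//.
rewrite -/(Z1) /mean_drift !unlock.
have Z1_fin_num : (\int[P]_w (Z1 w)%:E)%E \is a fin_num.
  exact: integrable_fin_num.
rewrite -[X in (X - _)%E]fineK// -[X in (_ - _ * X)%E]fineK// -EFinM -EFinB.
by rewrite divfK// subrr.
Qed.

Theorem mean_asymptotics_of_moments r : 0 < r <= 1 ->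
  (\int[P]_w (T1 w `^ (2 - r))%:E < +oo)%E ->
  (\int[P]_w (M1 w)%:E < +oo)%E ->
  (\int[P]_w (T1 w `^ (1 - r) * M1 w)%:E < +oo)%E ->
  mean_asymptotics P xi Z r.
Proof.
move=> r_itv Tp_fin M_fin TM_fin; have /andP[r0 r1] := r_itv.
have T_fin := T1_fin r_itv Tp_fin.
have mean0 := drifted_end_mean T_fin M_fin.
have T1_ge0 w : 0 <= T1 w by exact: ltW.
pose W w := 2 * M1 w + `|a| * T1 w.
have mW : measurable_fun setT W.
  by apply: measurable_funD; apply: measurable_funM.
have W_ge0 w : 0 <= W w by rewrite addr_ge0// mulr_ge0.
have W_fin : (\int[P]_w (W w)%:E < +oo)%E by exact: finite_mean_comb.
have WT_fin : (\int[P]_w (W w * T1 w `^ (1 - r))%:E < +oo)%E.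
  have WTE w : W w * T1 w `^ (1 - r) =
      2 * (T1 w `^ (1 - r) * M1 w) + `|a| * T1 w `^ (2 - r).
    have -> : T1 w `^ (2 - r) = T1 w * T1 w `^ (1 - r).
      rewrite -[X in _ = X * _]powRr1// -powRD; last by rewrite (gt_eqF (T1_gt0 w)) implybT.
      by congr (_ `^ _); ring.
    by rewrite /W; ring.
  under eq_integral do rewrite WTE.
  apply: finite_mean_comb => //.
  - exact: measurable_funM.
  - by move=> w; rewrite mulr_ge0// powR_ge0.
  - by move=> w; rewrite powR_ge0.
have boundE w : cycle_bound a (X 0%N w) = (W w)%:E.
  rewrite /cycle_bound -sup_first_cycleE -EFinM -EFinD /W T1E.
  by rewrite (ger0_norm (x := xi 0%N w))// -T1E.
have bound_fin : (\int[P]_w cycle_bound a (X 0%N w) < +oo)%E.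
  by under eq_integral do rewrite boundE.
have [_ X_iid] := Z_regenerative.
have [e [C [e0 C0 UC]]] := expected_renewals_bounded X_iid
  (measurable_fst : measurable_fun setT (@fst R (trajectory R)))
  (xi_renewal.2 : forall n w, 0 < (X n w).1).
have drift t (t0 : 0 <= t) := drifted_mean_le xi_renewal Z_cadlag
  Z_regenerative bound_fin mean0 e0 UC t0.
have ZE t w : (Z t w)%:E = ((drifted Z a t w)%:E + (a * t)%:E)%E.
  by rewrite -EFinD /drifted subrK.
have cst_int t : P.-integrable setT (EFin \o cst (a * t)).
  exact: finite_measure_integrable_cst.
have Z_int t : 0 <= t -> P.-integrable setT (EFin \o Z t).
  move=> t0; have [dr_int _] := drift t t0.
  rewrite (_ : EFin \o Z t = (EFin \o drifted Z a t) \+ (EFin \o cst (a * t))).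
    exact: integrableD.
  by apply/funext => w; exact: ZE.
split=> //; apply/eqaddoP => eps eps0.
(* [C + 1], since [C] may be zero. *)
have eC0 : 0 < eps / (C + 1) by rewrite divr_gt0// ltr_wpDl.
have [t1 long_le] := long_cycles_littleo r_itv mT1 mW T1_gt0 W_ge0 W_fin WT_fin
  e0 eC0.
near=> t.
have t0 : 0 <= t by near: t; exact: (nbhs_pinfty_ge (num_real 0)).
have t1t : t1 <= t by near: t; exact: (nbhs_pinfty_ge (num_real t1)).
have [dr_int dr_le] := drift t t0.
have dr_fin : (\int[P]_w (drifted Z a t w)%:E)%E \is a fin_num.
  exact: integrable_fin_num.
have -> : ((fun t => fine 'E_P[Z t]) - (fun t => a * t)) t =
    fine (\int[P]_w (drifted Z a t w)%:E).
  transitivity (fine (\int[P]_w (Z t w)%:E) - a * t); first by rewrite unlock.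
  under eq_integral do rewrite ZE.
  rewrite (integralD measurableT dr_int (cst_int t)).
  have -> : (\int[P]_w (EFin \o cst (a * t)%R) w = (a * t)%:E)%E.
    apply: etrans (integral_cst P (@measurableT _ Omega) (a * t)%:E) _.
    by rewrite -[RHS]mule1; congr (_ * _)%E; exact: probability_setT.
  by rewrite fineD//= addrK.
rewrite -lee_fin -abse_EFin fineK//; apply: le_trans dr_le _.
have T1xi : T1 = xi 0%N by apply/funext => w; rewrite T1E.
have := long_le t t1t; rewrite T1xi => sum_le.
under eq_bigr do under eq_integral do rewrite boundE.
apply: le_trans (lee_wpmul2l _ sum_le) _; first by rewrite lee_fin.
rewrite -EFinM lee_fin (ger0_norm (powR_ge0 _ _)) mulrA ler_wpM2r ?powR_ge0//.
rewrite mulrA ler_pdivrMr ?ltr_wpDl//.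
by rewrite mulrC ler_wpM2l ?(ltW eps0)// lerDl.
Unshelve. all: by end_near. Qed.

(** Young's inequality with exponents [(1 - q^-1)^-1] and [q]: the hypothesis on
    [p] and [q] says that the first of them, times [1 - r], is at most [p].  For
    [q = 1] that hypothesis forces [r = 1]. *)
Lemma first_cycle_moments_of_powers r p q : 0 < r <= 1 -> 2 - r <= p ->
  1 <= q -> 1 - r <= p * (1 - q^-1) ->
  (\int[P]_w (T1 w `^ p)%:E < +oo)%E -> (\int[P]_w (M1 w `^ q)%:E < +oo)%E ->
  [/\ (\int[P]_w (T1 w `^ (2 - r))%:E < +oo)%E,
      (\int[P]_w (M1 w)%:E < +oo)%E &
      (\int[P]_w (T1 w `^ (1 - r) * M1 w)%:E < +oo)%E].
Proof.
move=> /andP[r0 r1] rp q1 pq Tp_fin Mq_fin.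
have T1_ge0 w : 0 <= T1 w by exact: ltW.
have M1_fin : (\int[P]_w (M1 w)%:E < +oo)%E.
  under eq_integral do rewrite -[M1 _]powRr1//.
  by apply: finite_mean_pow Mq_fin => //; rewrite ler01.
split=> //; first by apply: finite_mean_pow Tp_fin => //; apply/andP; split; lra.
move: q1; rewrite le_eqVlt => /predU1P[q1|q1].
  have -> : r = 1 by apply/le_anti; rewrite r1; move: pq; rewrite -q1 invr1; lra.
  by under eq_integral do rewrite subrr powRr0 mul1r.
have q0 : 0 < q by exact: lt_trans ltr01 q1.
have s0 : 0 < 1 - q^-1 by rewrite subr_gt0 invf_lt1.
apply: (@finite_mean_mul _ _ _ _ _ _ (1 - q^-1)^-1 q) => //.
- by move=> w; exact: powR_ge0.
- by rewrite invr_gt0.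
- by rewrite invrK subrK.
under eq_integral do rewrite -powRrM.
apply: finite_mean_pow Tp_fin => //; apply/andP; split.
  by rewrite divr_ge0 ?(ltW s0)// subr_ge0.
by rewrite ler_pdivrMr.
Qed.

End first_cycle_moments.

Unset Implicit Arguments.

Theorem theorem5p4 (d : measure_display) (Omega : measurableType d)
    (R : realType) (P : probability Omega R)
    (xi : nat -> Omega -> R) (Z : R -> Omega -> R) (r : R)
    (hxi : renewal_steps P xi)
    (hZ : cadlag_process Z)
    (hreg : regenerative_increments P xi Z)
    (hr : 0 < r <= 1) :
  let T1 := renewal_time xi 1 in
  let M1 := sup_first_cycle xi Z in
  (('E_P[fun w => (T1 w `^ (2 - r))%R])%E \is a fin_num ->
   'E_P[M1]%E \is a fin_num ->
   ('E_P[fun w => (T1 w `^ (1 - r) * M1 w)%R])%E \is a fin_num ->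
   mean_asymptotics P xi Z r)
  /\
  ((exists p q : R,
      [/\ 2 - r <= p, 1 <= q,
          ('E_P[fun w => (T1 w `^ p)%R])%E \is a fin_num,
          ('E_P[fun w => (M1 w `^ q)%R])%E \is a fin_num
        & 1 - r <= p * (1 - q^-1)]) ->
   mean_asymptotics P xi Z r).
Proof.
move=> T1 M1.
have mean_fin V : 'E_P[V]%E \is a fin_num -> (\int[P]_w (V w)%:E < +oo)%E.
  by rewrite unlock ltey_eq => ->.
have part_i := mean_asymptotics_of_moments hxi hZ hreg hr.
split=> [/mean_fin T_fin /mean_fin M_fin /mean_fin TM_fin|].
  exact: part_i.
move=> [p [q [rp q1 /mean_fin Tp_fin /mean_fin Mq_fin pq]]].
have [] := first_cycle_moments_of_powers hxi hZ hreg hr rp q1 pq Tp_fin Mq_fin.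
exact: part_i.
Qed.
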